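(* Let $G$ be a finite simple graph that is ($P_6$, apple, torch)-free, i.e. no induced subgraph of $G$ is isomorphic to $P_6$, to the apple, or to the torch. If $\Delta(G)\ge 9$, then $\chi(G)\le \max\{\Delta(G)-1,\ \omega(G)\}$.
   Context: All graphs are finite and simple. $\Delta(G)$, $\chi(G)$ and $\omega(G)$ denote the maximum degree, chromatic number and clique number of $G$. $P_k$ and $C_k$ denote the path and the cycle on $k$ vertices. The apple is the graph on $6$ vertices consisting of a cycle $C_5$ together with one further vertex adjacent to exactly one vertex of the cycle (an induced $C_5$ with a hanging edge). The torch is the graph on $6$ vertices consisting of an induced $C_5$ and an induced $C_4$ sharing exactly an induced $P_3$; that is, a cycle $v_1v_2v_3v_4v_5v_1$ together with one further vertex $w$ adjacent to exactly $v_1$ and $v_3$. *)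

(* Defs.v *)
From mathcomp Require Import all_boot.

Set Implicit Arguments.
Unset Strict Implicit.
Unset Printing Implicit Defensive.

Record sgraph := SGraph {
  vertex :> finType;
  edge : rel vertex;
  edge_sym : symmetric edge;
  edge_irrefl : irreflexive edge }.

Definition iso (G H : sgraph) : Prop :=
  exists2 f : G -> H, bijective f & forall x y, edge (f x) (f y) = edge x y.

Section Induced.
Variables (G : sgraph) (S : {set G}).

Definition induced_edge : rel {x : G | x \in S} :=
  fun x y => edge (val x) (val y).

Lemma induced_sym : symmetric induced_edge.
Proof. by move=> x y; apply: edge_sym. Qed.

Lemma induced_irrefl : irreflexive induced_edge.
Proof. by move=> x; apply: edge_irrefl. Qed.

Definition induced : sgraph := SGraph induced_sym induced_irrefl.
End Induced.

Definition free (H G : sgraph) : Prop := forall S : {set G}, ~ iso (induced S) H.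

(* The graph on {0, ..., n-1} whose edges are the pairs listed in s; each
   edge is listed once, in either order. *)
Section EdgeList.
Variables (n : nat) (s : seq (nat * nat)).

Definition list_edge : rel 'I_n :=
  fun i j => (i != j) &&
    (((val i, val j) \in s) || ((val j, val i) \in s)).

Lemma list_sym : symmetric list_edge.
Proof. by move=> i j; rewrite /list_edge eq_sym orbC. Qed.

Lemma list_irrefl : irreflexive list_edge.
Proof. by move=> i; rewrite /list_edge eqxx. Qed.

Definition list_graph : sgraph := SGraph list_sym list_irrefl.
End EdgeList.

Definition P6 : sgraph :=
  list_graph 6 [:: (0, 1); (1, 2); (2, 3); (3, 4); (4, 5)].

Definition C5_edges : seq (nat * nat) :=
  [:: (0, 1); (1, 2); (2, 3); (3, 4); (4, 0)].

Definition apple : sgraph := list_graph 6 ((5, 0) :: C5_edges).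

(* The cycle v_1 ... v_5 is 0 ... 4, and w is 5. *)
Definition torch : sgraph := list_graph 6 [:: (5, 0), (5, 2) & C5_edges].

Section Invariants.
Variable G : sgraph.

Definition degree (x : G) : nat := #|[set y | edge x y]|.

Definition max_degree : nat := \max_(x : G) degree x.

Definition clique (K : {set G}) : bool :=
  [forall x in K, forall y in K, (x != y) ==> edge x y].

Definition clique_number : nat := \max_(K : {set G} | clique K) #|K|.

Definition colorable (k : nat) : bool :=
  [exists f : {ffun G -> 'I_k}, forall x, forall y, edge x y ==> (f x != f y)].

Lemma colorable_ex : exists k, colorable k.
Proof.
exists #|G|; apply/existsP; exists [ffun x => enum_rank x].
apply/forallP=> x; apply/forallP=> y; apply/implyP=> xy.
rewrite !ffunE (inj_eq enum_rank_inj); apply: contraL xy => /eqP ->.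
by rewrite edge_irrefl.
Qed.

Definition chromatic_number : nat := ex_minn colorable_ex.
End Invariants.

(* Main.v *)
Require Import Defs.
From mathcomp Require Import all_boot zify.

(* Put k = max (Delta - 1, omega), so that k >= 8, all degrees are at most k + 1
   and there is no clique on k + 1 vertices; take G vertex-critical among the
   graphs that are not k-colourable. Colour G - v with k colours.

   Two nonadjacent neighbours x, y of v whose colours i, j occur once around v
   are joined by a Kempe chain, which yields an induced 5-cycle v, x, a, b, y
   coloured i, j, i, j. As apple and torch are excluded, a is the only neighbour
   of x coloured j, so one may colour v with i and uncolour x instead: the roles
   of the five vertices can be permuted by the full dihedral group. Around an
   uncoloured vertex at most one colour occurs more than once. As k - 2 > 5, some
   colour l other than i, j occurs exactly once around each vertex of the cycle,
   and a look at how the neighbours coloured l share the cycle gives a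
   contradiction.

   Hence the uniquely coloured neighbours of v form a clique, and v lies in a
   clique Q of size k and has two further neighbours, of the same colour; by
   Kempe chains again, each vertex of Q is adjacent to one of these two. It
   follows that two distinct cliques of size k meet, in k - 1 or k - 2 vertices,
   and then a colouring of the rest of G extends. *)

Set Implicit Arguments.
Unset Strict Implicit.
Unset Printing Implicit Defensive.

(** * Forbidden induced subgraphs *)

Lemma free_embed (H G : sgraph) (h : H -> G) :
  free H G -> injective h -> (forall i j, edge (h i) (h j) = edge i j) -> False.
Proof.
move=> HG inj_h hE; set S := [set h i | i in H].
have hS i : h i \in S by apply: imset_f.
pose g i : induced S := exist _ (h i) (hS i).
have inj_g : injective g by move=> i j /(congr1 val); apply: inj_h.
have [|f gK fK] := inj_card_bij inj_g; first by rewrite card_sig card_imset.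
apply: (HG S); exists f; first by exists g.
by move=> x y; rewrite -hE -[in RHS](fK x) -[in RHS](fK y).
Qed.

Lemma free_induced (H G : sgraph) (S : {set G}) : free H G -> free H (induced S).
Proof.
move=> HG S' [f [g fK gK] fE].
apply: (free_embed (h := fun i => val (val (g i))) HG).
  by move=> i j /val_inj/val_inj/(can_inj gK).
by move=> i j; rewrite -[in RHS](gK i) -[in RHS](gK j) fE.
Qed.

Lemma free6 (G : sgraph) (s : seq (nat * nat)) (v : seq G) (v0 : G) :
  free (list_graph 6 s) G -> uniq v -> size v = 6 ->
  (forall i j : 'I_6, edge (nth v0 v i) (nth v0 v j) = list_edge s i j) -> False.
Proof.
move=> HG Uv sz_v vE; apply: (free_embed (h := fun i : list_graph 6 s => nth v0 v (i : 'I_6)) HG) => //.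
move=> i j /eqP; rewrite nth_uniq ?sz_v //; by move/eqP/val_inj.
Qed.

Ltac adj := repeat match goal with
  | H : is_true (edge ?x ?y) |- context [edge ?x ?y] => rewrite H
  | H : is_true (edge ?x ?y) |- context [edge ?y ?x] => rewrite [edge y x]edge_sym H
  | H : edge ?x ?y = _ |- context [edge ?x ?y] => rewrite H
  | H : edge ?x ?y = _ |- context [edge ?y ?x] => rewrite [edge y x]edge_sym H
  | |- context [edge ?x ?x] => rewrite [edge x x]edge_irrefl
  end.

Ltac absurd_adj := match goal with
  | H : is_true (edge ?x ?x) |- _ => by rewrite edge_irrefl in H
  | H : is_true (edge ?x ?y), H' : edge ?x ?y = false |- _ => by rewrite H in H'
  | H : is_true (edge ?x ?y), H' : edge ?y ?x = false |- _ =>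
     by rewrite edge_sym H in H'
  | H : is_true (?x != ?x) |- _ => by rewrite eqxx in H
  end.

Ltac distinct := rewrite /= !inE !negb_or ?andbT; repeat (apply/andP; split);
  by apply/eqP => ?; subst; absurd_adj.

Ltac check_edges :=
  case=> [[|[|[|[|[|[|i]]]]]] //= ?] [[|[|[|[|[|[|j]]]]]] //= ?];
  rewrite /list_edge /= ?edge_irrefl //=; by adj.

Lemma P6_free_path (G : sgraph) (p0 p1 p2 p3 p4 p5 : G) : free P6 G ->
  edge p0 p1 -> edge p1 p2 -> edge p2 p3 -> edge p3 p4 -> edge p4 p5 ->
  edge p0 p2 = false -> edge p0 p3 = false -> edge p0 p4 = false ->
  edge p0 p5 = false -> edge p1 p3 = false -> edge p1 p4 = false ->
  edge p1 p5 = false -> edge p2 p4 = false -> edge p2 p5 = false ->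
  edge p3 p5 = false -> False.
Proof.
move=> HG; intros; apply: (free6 (v := [:: p0; p1; p2; p3; p4; p5]) (v0 := p0) HG) => //.
  by distinct.
by check_edges.
Qed.

Definition C5 (G : sgraph) (c0 c1 c2 c3 c4 : G) :=
  [/\ edge c0 c1, edge c1 c2, edge c2 c3, edge c3 c4 & edge c4 c0]
  /\ [/\ edge c0 c2 = false, edge c0 c3 = false, edge c1 c3 = false,
         edge c1 c4 = false & edge c2 c4 = false].

Lemma C5_rot (G : sgraph) (c0 c1 c2 c3 c4 : G) : C5 c0 c1 c2 c3 c4 -> C5 c1 c2 c3 c4 c0.
Proof. by case=> [[? ? ? ? ?] [? ? ? ? ?]]; do 2!split=> //; adj. Qed.

Lemma apple_free_C5 (G : sgraph) (c0 c1 c2 c3 c4 u : G) : free apple G ->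
  C5 c0 c1 c2 c3 c4 -> edge u c0 -> edge u c1 = false -> edge u c2 = false ->
  edge u c3 = false -> edge u c4 = false -> False.
Proof.
move=> HG [[? ? ? ? ?] [? ? ? ? ?]]; intros.
apply: (free6 (v := [:: c0; c1; c2; c3; c4; u]) (v0 := u) HG) => //.
  by distinct.
by check_edges.
Qed.

Lemma torch_free_C5 (G : sgraph) (c0 c1 c2 c3 c4 u : G) : free torch G ->
  C5 c0 c1 c2 c3 c4 -> u != c1 -> edge u c0 -> edge u c1 = false -> edge u c2 ->
  edge u c3 = false -> edge u c4 = false -> False.
Proof.
move=> HG [[? ? ? ? ?] [? ? ? ? ?]]; intros.
apply: (free6 (v := [:: c0; c1; c2; c3; c4; u]) (v0 := u) HG) => //.
  by distinct.
by check_edges.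
Qed.

(** Here [a] and [b] stand for the sizes of two subsets of a set of size [k.-1], and [c] for the
    size of their intersection. *)
Lemma overlap_gt0 k a b c : 8 <= k -> k - 2 <= a -> k - 2 <= b -> a + b <= k.-1 + c -> 0 < c.
Proof. lia. Qed.

(** * Partial colourings and Kempe chains *)

Section Critical.

Variables (G : sgraph) (k : nat).
Hypotheses (P6G : free P6 G) (appleG : free apple G) (torchG : free torch G).
Hypothesis k_ge8 : 8 <= k.
Hypothesis degG : forall x : G, degree x <= k.+1.
Hypothesis colG : ~~ colorable G k.

Implicit Types (f : G -> option 'I_k) (u v w x y : G) (c d l : 'I_k).

(* A proper colouring of G - v, extended by [None] at v. *)
Definition partial v f :=
  (forall u, (f u == None) = (u == v)) /\ (forall u w, edge u w -> f u != f w).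

Lemma partial_same v f u w : partial v f -> f u = f w -> edge u w = false.
Proof. by case=> _ fP fuw; apply/negP=> /fP; rewrite fuw eqxx. Qed.

Lemma partial_Some v f u : partial v f -> edge v u -> exists i, f u = Some i.
Proof.
case=> f0 fP vu; have := fP _ _ vu; have /eqP-> : f v == None by rewrite f0.
by case: (f u) => // i _; exists i.
Qed.

Lemma uncolorable (g : G -> 'I_k) : exists u w, edge u w /\ g u = g w.
Proof.
move: colG; rewrite negb_exists => /forallP/(_ [ffun u => g u]).
case/forallPn=> u /forallPn[w]; rewrite negb_imply !ffunE negbK => /andP[uw /eqP guw].
by exists u, w.
Qed.

(** Otherwise giving [c] to v would colour all of G. *)
Lemma sees v f c : partial v f -> exists2 u, edge v u & f u = Some c.
Proof.
(* The default [c] is used at v only, so a monochromatic edge must contain v. *)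
case=> f0 fP; have [u [w [uw]]] := uncolorable (fun u => odflt c (f u)).
have := fP _ _ uw; have := f0 u; have := f0 w.
case Efu: (f u) => [i|]; case Efw: (f w) => [j|] //=.
- by move=> _ _ + ij; rewrite ij eqxx.
- by move=> /esym/eqP Ew _ _ ic; exists u; rewrite -?Ew 1?edge_sym // Efu ic.
- by move=> _ /esym/eqP Eu _ jc; exists w; rewrite -?Eu // Efw jc.
Qed.

Definition ncol f v c := #|[set u | edge v u & f u == Some c]|.

Lemma sum_ncol v f : partial v f -> \sum_c ncol f v c = degree v.
Proof.
case=> f0 fP; have k0 : 0 < k by apply: leq_trans k_ge8.
rewrite /degree -sum1_card (partition_big (fun u => odflt (Ordinal k0) (f u)) xpredT) //=.
apply: eq_bigr => c _; rewrite /ncol -sum1_card; apply: eq_bigl => u; rewrite !inE.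
case vu: (edge v u) => //=; have := f0 u; case: (f u) => //= /esym/eqP Eu.
by rewrite Eu edge_irrefl in vu.
Qed.

Lemma ncol_gt0 v f c : partial v f -> 0 < ncol f v c.
Proof.
by move=> fv; have [u vu /eqP fu] := sees c fv; apply/card_gt0P; exists u; rewrite inE vu.
Qed.

(** All k colours occur around v and its degree is at most k + 1, which leaves room for a single
    repetition. *)
Lemma card_not_once v f : partial v f -> #|[set c | ncol f v c != 1]| <= 1.
Proof.
move=> fv; rewrite -(leq_add2l k) addn1; apply: leq_trans (degG v).
rewrite -(sum_ncol fv) -[X in X + _]card_ord -sum1_card -sum1_card.
rewrite [X in _ + X]big_mkcond -big_split /=; apply: leq_sum => c _; rewrite inE.
by case: eqP (ncol_gt0 c fv) => [->//|] /=; case: ncol => [//|[//|n]].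
Qed.

Definition shift f v x u := if u == v then f x else if u == x then None else f u.

Definition sole f v x := forall u, edge v u -> f u = f x -> u = x.

Lemma partial_shift v f x : partial v f -> edge v x -> sole f v x ->
  partial x (shift f v x).
Proof.
case=> f0 fP vx fx; have vNx : v != x by apply: contraTN vx => /eqP->; rewrite edge_irrefl.
split=> [u|u w]; rewrite /shift.
  case: (u =P v) => [->|/eqP uNv]; first by rewrite f0 eq_sym.
  by case: (u =P x) => //= _; rewrite f0 (negPf uNv).
case: (u =P v) => [->|/eqP uNv]; case: (w =P v) => [->|/eqP wNv].
- by rewrite edge_irrefl.
- case: (w =P x) => [_ _|wNx vw]; first by rewrite f0 eq_sym.
  by apply: contra_notN wNx => /eqP/esym/(fx _ vw).
- case: (u =P x) => [_ _|uNx]; first by rewrite eq_sym f0 eq_sym.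
  by rewrite edge_sym => vu; apply: contra_notN uNx => /eqP/(fx _ vu).
case: (u =P x) => [->|_]; case: (w =P x) => [->|_]; last exact: fP.
- by rewrite edge_irrefl.
- by rewrite eq_sym f0.
- by rewrite f0.
Qed.

(* Were no neighbour of v coloured c reachable from x in the subgraph induced
   by the colours of x and c, swapping the two colours on the component of x
   would free the colour of x at v. As G is P6-free, that component consists of
   the vertices at distance at most 4 from x, listed by A1, ..., A4. *)
Lemma kempe v f x c : partial v f -> edge v x -> sole f v x -> f x != Some c ->
    (forall w, edge v w -> f w = Some c -> edge x w = false) ->
  exists a b w, [/\ C5 v x a b w, f a = Some c, f b = f x & f w = Some c].
Proof.
move=> fv vx xU fxc xN; have [f0 fP] := fv.
pose A1 z := (f z == Some c) && edge x z.
pose A2 z := (f z == f x) && [exists y, A1 y && edge y z].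
pose A3 z := (f z == Some c) && [exists y, A2 y && edge y z].
pose A4 z := (f z == f x) && [exists y, A3 y && edge y z].
pose D z := [|| z == x, A1 z, A2 z, A3 z | A4 z].
(* A vertex z of colour [c] next to the last layer lies in an earlier one: otherwise x, s1, s2, s3,
   y, z would be an induced path. *)
have A4D y z : A4 y -> edge y z -> f z = Some c -> A1 z || A3 z.
  case/andP=> /eqP fy /existsP[s3 /andP[A3s /[dup] s3y]].
  case/andP: (A3s) => /eqP fs3 /existsP[s2 /andP[A2s s23]] _ yz fz.
  case/andP: (A2s) => /eqP fs2 /existsP[s1 /andP[/[dup] A1s /andP[/eqP fs1 xs1]] s12].
  rewrite -[_ || _]negbK negb_or; apply/negP=> /andP[]; rewrite /A1 /A3 fz eqxx /=.
  move=> xz /existsPn s2z; have {}s2z t : A2 t -> edge t z = false.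
    by move=> A2t; have := s2z t; rewrite A2t => /negPf.
  have NA2y : A2 y = false by apply/negP => /s2z; rewrite yz.
  apply: (P6_free_path P6G xs1 s12 s23 s3y yz).
  - by apply: (partial_same fv).
  - apply: contraFF NA2y => xs3; rewrite /A2 fy eqxx; apply/existsP; exists s3.
    by rewrite /A1 fs3 eqxx xs3.
  - by apply: (partial_same fv).
  - exact: negPf xz.
  - by apply: (partial_same fv); rewrite fs1.
  - by apply: contraFF NA2y => s1y; rewrite /A2 fy eqxx; apply/existsP; exists s1; rewrite A1s.
  - by apply: (partial_same fv); rewrite fs1.
  - by apply: (partial_same fv); rewrite fs2.
  - exact: s2z.
  - by apply: (partial_same fv); rewrite fs3.
have Dcol z : D z -> f z = f x \/ f z = Some c.
  by case/or4P => [/eqP->|/andP[/eqP]|/andP[/eqP]|/orP[]/andP[/eqP]]; auto.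
have Dclosed y z : D y -> edge y z -> f z = f x \/ f z = Some c -> D z.
  move=> Dy yz fz; have fyz := fP _ _ yz; rewrite /D.
  case/or4P: Dy => [/eqP Ey|A|A|/orP[]A].
  - by subst y; case: fz fyz => [->|fz _]; rewrite ?eqxx // /A1 fz eqxx yz !orbT.
  - case/andP: (A) fz fyz => /eqP-> _ [fz|->]; rewrite ?eqxx // => _.
    suff -> : A2 z by rewrite !orbT.
    by rewrite /A2 fz eqxx; apply/existsP; exists y; rewrite A.
  - case/andP: (A) fz fyz => /eqP-> _ [->|fz]; rewrite ?eqxx // => _.
    suff -> : A3 z by rewrite !orbT.
    by rewrite /A3 fz eqxx; apply/existsP; exists y; rewrite A.
  - case/andP: (A) fz fyz => /eqP-> _ [fz|->]; rewrite ?eqxx // => _.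
    suff -> : A4 z by rewrite !orbT.
    by rewrite /A4 fz eqxx; apply/existsP; exists y; rewrite A.
  - case/andP: (A) fz fyz => /eqP-> _ [->|fz]; rewrite ?eqxx // => _.
    by case/orP: (A4D _ _ A yz fz) => ->; rewrite !orbT.
have fxN : f x != None.
  by rewrite f0; apply: contraTN vx => /eqP->; rewrite edge_irrefl.
have cfx : (Some c == f x) = false by rewrite eq_sym (negPf fxc).
pose g z := if D z then (if f z == f x then Some c else f x) else f z.
have gD z : D z -> g z = f x \/ g z = Some c.
  by rewrite /g => ->; case: ifP; auto.
have gN u w : D u -> D w = false -> edge u w -> g u != g w.
  move=> Du Dw uw; apply/eqP => guw; have := Dclosed u w Du uw.
  by rewrite Dw => gw; have := gD u Du; rewrite guw {1 2}/g Dw; move/gw.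
have gv : partial v g.
  split=> [u|u w uw].
    rewrite -f0; case Du: (D u); last by rewrite /g Du.
    have -> : (f u == None) = false by case: (Dcol u Du) => ->; rewrite ?(negPf fxN).
    by case: (gD u Du) => ->; rewrite ?(negPf fxN).
  case Du: (D u); case Dw: (D w).
  - have := fP _ _ uw; rewrite /g Du Dw; case: (Dcol u Du) => ->; case: (Dcol w Dw) => ->.
    + by rewrite eqxx.
    + by rewrite eqxx cfx /= cfx.
    + by rewrite eqxx cfx.
    + by rewrite eqxx.
  - exact: gN.
  - by rewrite eq_sym; apply: gN; rewrite 1?edge_sym.
  - by rewrite /g Du Dw; apply: fP.
(* After the swap v still sees the colour of x, at a vertex w that lies in [D] and had colour [c],
   hence in [A1] or [A3]. The hypothesis on x excludes [A1], and [A3] yields the path x, a, b, w. *)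
case Efx: (f x) fxN fxc => [i|//] _ ic; have [w vw] := sees i gv.
rewrite -Efx /g; case: ifP => [Dw|Dw fw]; last by rewrite (xU _ vw fw) /D eqxx in Dw.
case: eqP => [fw /esym fxc|fw _]; first by rewrite -Efx fxc eqxx in ic.
have {Dw} [|/andP[/eqP fwc /existsP[b /andP[A2b bw]]]] : A1 w \/ A3 w.
- case/or4P: Dw => [/eqP Ew|A|/andP[/eqP]|/orP[A|/andP[/eqP]]] //; auto.
  by rewrite Ew in fw.
- by case/andP=> /eqP fwc; rewrite xN.
case/andP: A2b => /eqP fb /existsP[a /andP[/andP[/eqP fa xa] ab]].
have xw := xN _ vw fwc; exists a, b, w; split=> //.
do 2!split => //; try by rewrite edge_sym.
- by apply: contraTF xa => va; rewrite xN.
- by apply/negP=> vb; move: xw; rewrite -(xU b vb _) ?bw // fb.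
- by apply: (partial_same fv); rewrite Efx fb.
- by apply: (partial_same fv); rewrite fa.
Qed.

(** * Bicoloured 5-cycles through the uncoloured vertex *)

(** If u misses [c1] and [c4], then [c0] as its only neighbour on the cycle gives an apple, and [c0]
    with exactly one of [c2], [c3] a torch. The two disequalities keep u off the cycle. *)
Lemma C5_link (c0 c1 c2 c3 c4 u : G) : C5 c0 c1 c2 c3 c4 -> u != c1 -> u != c4 ->
  edge c0 u -> [|| edge c1 u, edge c4 u | edge c2 u && edge c3 u].
Proof.
move=> C u1 u4 c0u; have [[? ? ? ? ?] [? ? ? ? ?]] := C.
apply/negPn/negP; rewrite !negb_or negb_and => /and3P[/negPf c1u /negPf c4u].
case c2u: (edge c2 u); case c3u: (edge c3 u) => //= _.
- by apply: (torch_free_C5 torchG C u1); adj.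
- have C' : C5 c0 c4 c3 c2 c1 by do 2!split=> //; adj.
  by apply: (torch_free_C5 torchG C' u4); adj.
- by apply: (apple_free_C5 appleG C (u := u)); adj.
Qed.

Record config f v x a b y : Prop := Config {
  config_partial : partial v f;
  config_C5 : C5 v x a b y;
  config_a : f a = f y;
  config_b : f b = f x;
  config_neq : f x != f y;
  config_sole_x : sole f v x;
  config_sole_y : sole f v y }.

Lemma config_sym f v x a b y : config f v x a b y -> config f v y b a x.
Proof.
case=> ? [[? ? ? ? ?] [? ? ? ? ?]] ? ? ? ? ?; split=> //; last by rewrite eq_sym.
by do 2!split=> //; adj.
Qed.

(** A second such neighbour u of x would be nonadjacent to v, around which the colour of y occurs
    only at y, and to a and y, which share its colour. This contradicts [C5_link] at x. *)
Lemma config_sole_a f v x a b y u :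
  config f v x a b y -> edge x u -> f u = f y -> u = a.
Proof.
case=> fv C fa fb fxy xU yU xu fu; have [[vx xa ab yb yv] [va vb xb xy ay]] := C.
apply/eqP/negPn/negP=> ua.
have vu : edge v u = false.
  by apply/negP=> vu; rewrite -(yU u vu fu) xu in xy.
have au : edge a u = false by apply: (partial_same fv); rewrite fa fu.
have yu : edge y u = false by apply: (partial_same fv); rewrite fu.
have uv : u != v by have [_ /(_ _ _ yv)] := fv; apply: contraNneq => <-; rewrite fu.
have := C5_link (C5_rot C) ua uv xu; by rewrite vu au yu andbF.
Qed.

Lemma shift_eq f v x l u : partial v f -> f x != Some l ->
  (shift f v x u == Some l) = (f u == Some l).
Proof.
case=> f0 _ /negPf xl; rewrite /shift; case: (u =P v) => [->|_].
  by have /eqP-> : f v == None; rewrite ?f0 // xl.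
by case: (u =P x) => // ->; rewrite xl.
Qed.

(** This reflection exchanges v with x and a with y; together with [config_sym] it generates the
    dihedral group of the cycle. That a is the sole vertex of its colour around x is
    [config_sole_a]. *)
Lemma config_rot f v x a b y :
  config f v x a b y -> config (shift f v x) x v y b a.
Proof.
move=> cf; have [fv C fa fb fxy xU yU] := cf; have [f0 fP] := fv.
have [[vx xa ab yb yv] [va vb xb xy ay]] := C.
have vNa : (a == v) = false by apply: contraFF vb => /eqP<-; adj.
have vNb : (b == v) = false by apply: contraFF va => /eqP<-; adj.
have vNy : (y == v) = false by apply: contraTF yv => /eqP->; adj.
have vNx : (x == v) = false by apply: contraTF vx => /eqP->; adj.
have xNa : (a == x) = false by apply: contraTF xa => /eqP->; adj.
have xNb : (b == x) = false by apply: contraFF xy => /eqP<-; adj.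
have xNy : (y == x) = false by apply: contraFF xb => /eqP<-; adj.
have fv0 : shift f v x v = f x by rewrite /shift eqxx.
have [fa0 fb0 fy0] : [/\ shift f v x a = f a, shift f v x b = f b & shift f v x y = f y].
  by rewrite /shift vNa vNb vNy xNa xNb xNy.
split; rewrite ?fv0 ?fa0 ?fb0 ?fy0 ?fa //.
- exact: partial_shift.
- by do 2!split=> //; adj.
- move=> u xu; rewrite fv0 /shift; case: (u =P v) => // _.
  by case: (u =P x) xu => [->|_ xu fux]; rewrite ?edge_irrefl //; have := fP _ _ xu; rewrite fux eqxx.
- move=> u xu; rewrite fa0 fa /shift; case: (u =P v) => [_|_].
    by move/eqP; rewrite (negPf fxy).
  by case: (u =P x) xu => [->|_ xu]; rewrite ?edge_irrefl //; apply: config_sole_a cf _.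
Qed.

(** * A further colour around the 5-cycle *)

Definition off f x y l := (Some l != f x) && (Some l != f y).

Definition not_once f x y u := [set l | off f x y l & ncol f u l != 1].

Lemma not_once_sym f x y u : not_once f x y u = not_once f y x u.
Proof. by apply/setP=> l; rewrite !inE /off [(_ != f x) && _]andbC. Qed.

Lemma not_once_center f v x a b y : config f v x a b y -> #|not_once f x y v| <= 1.
Proof.
case=> fv _ _ _ _ _ _; apply: leq_trans (card_not_once fv).
by apply/subset_leq_card/subsetP=> l; rewrite !inE => /andP[].
Qed.

(** The shift moves only the colour of x, which [off] leaves out. *)
Lemma not_once_shift f v x a b y u : config f v x a b y ->
  not_once (shift f v x) v a u = not_once f x y u.
Proof.
move=> cf; have [fv [[vx xa ab yb yv] [va vb _ _ _]] fa fb fxy _ _] := cf.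
have [fv' _ ba _ _ _ _] := config_rot cf.
have fva : shift f v x a = f y.
  rewrite /shift -fa; have -> : (a == v) = false by apply: contraFF vb => /eqP<-; adj.
  by have -> : (a == x) = false by apply: contraTF xa => /eqP->; adj.
apply/setP=> l; rewrite !inE /off fva {1}/shift eqxx.
case xl: (Some l == f x) => //=; congr (_ && (_ != 1)); apply: eq_card => w.
by rewrite !inE (shift_eq w fv) // eq_sym xl.
Qed.

(** Reflections make any of the five vertices the uncoloured one without changing the count of any
    colour other than those of x and y; [card_not_once] then applies to that vertex. *)
Lemma not_once_card f v x a b y : config f v x a b y ->
  [/\ #|not_once f x y v| <= 1, #|not_once f x y x| <= 1, #|not_once f x y a| <= 1,
      #|not_once f x y b| <= 1 & #|not_once f x y y| <= 1].
Proof.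
have side g v' x' a' b' y' : config g v' x' a' b' y' -> #|not_once g x' y' x'| <= 1.
  by move=> cf; rewrite -(not_once_shift _ cf) (not_once_center (config_rot cf)).
have far g v' x' a' b' y' : config g v' x' a' b' y' -> #|not_once g x' y' a'| <= 1.
  move=> cf; rewrite -(not_once_shift _ cf) not_once_sym.
  exact: side (config_sym (config_rot cf)).
move=> cf; have fc := config_sym cf; split.
- exact: not_once_center cf.
- exact: side cf.
- exact: far cf.
- by rewrite not_once_sym; apply: far fc.
- by rewrite not_once_sym; apply: side fc.
Qed.

Definition once f l u t :=
  [/\ edge u t, f t = Some l & forall w, edge u w -> f w = Some l -> w = t].

Lemma ncol1_once f l u : ncol f u l = 1 -> exists t, once f l u t.
Proof.
move=> /eqP/cards1P[t Et]; exists t.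
have := set11 t; rewrite -Et inE => /andP[ut /eqP ft]; split=> // w uw fw.
by apply/set1P; rewrite -Et inE uw fw eqxx.
Qed.

Lemma once_shift f v x l u t : partial v f -> f x != Some l ->
  once f l u t -> once (shift f v x) l u t.
Proof.
move=> fv xl [ut ft tU]; split=> //; first by apply/eqP; rewrite shift_eq // ft.
by move=> w uw /eqP; rewrite shift_eq // => /eqP; apply: tU.
Qed.

(** The five vertices exclude at most five colours, while at least k - 2, hence six, colours differ
    from those of x and y. *)
Lemma exists_once f v x a b y : config f v x a b y -> exists2 l, off f x y l &
  [/\ exists t, once f l v t, exists t, once f l x t, exists t, once f l a t,
      exists t, once f l b t & exists t, once f l y t].
Proof.
move=> cf; have [nv nx na nb ny] := not_once_card cf.
pose B := not_once f x y v :|: not_once f x y x :|: not_once f x y a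
  :|: not_once f x y b :|: not_once f x y y.
have cB : #|B| <= 5.
  have sz (A C : {set 'I_k}) m : #|A| <= m -> #|C| <= 1 -> #|A :|: C| <= m.+1.
    by move=> Am C1; rewrite (leq_trans (leq_card_setU _ _).1) // -addn1 leq_add.
  by rewrite !sz.
have offP : 6 <= #|[set l | off f x y l]|.
  pose A u := [set l | Some l == f u].
  have A1 u : #|A u| <= 1.
    by apply/card_le1_eqP => l m; rewrite !inE => /eqP<- /eqP[].
  have -> : [set l | off f x y l] = ~: (A x :|: A y).
    by apply/setP=> l; rewrite !inE negb_or.
  rewrite cardsCs setCK card_ord -[6]/(8 - 2) leq_sub //.
  by rewrite (leq_trans (leq_card_setU _ _).1) // -[2]/(1 + 1) leq_add.
have /subsetPn[l] : ~~ ([set l | off f x y l] \subset B).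
  by apply: contraL offP => /subset_leq_card le; rewrite -ltnNge ltnS (leq_trans le).
rewrite !inE => lo; rewrite lo !negb_or !negbK /=.
case/andP=> /andP[/andP[/andP[v1 x1] a1] b1] y1; exists l => //.
by split; apply/ncol1_once/eqP.
Qed.

(* The chain from t to y in the colours l and f y is t, p, e, y, and p has no
   neighbour on the 5-cycle: with x replaced by t, it hangs on t as an apple.
   The other positions of the path seen by t follow from [config_sym] and
   [config_rot]. *)
Lemma no_path_at_x f v x a b y l t e : config f v x a b y -> off f x y l ->
  once f l v t -> once f l x t -> once f l a t -> once f l b e -> once f l y e ->
  t <> e -> False.
Proof.
move=> cf /andP[lx ly] [vt ft tv] [xt _ tx] [at_ _ ta] [be fe eb] [ye _ ey] te.
have [fv C fa fb fxy xU yU] := cf; have [[vx xa ab yb yv] [va vb xb xy ay]] := C.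
have [j fy] : exists j, f y = Some j by apply: (partial_Some fv); rewrite edge_sym.
have bt : edge b t = false by apply/negP=> bt; apply: te; apply: eb.
have yt : edge y t = false by apply/negP=> yt; apply: te; apply: ey.
have ae : edge a e = false by apply/negP=> ae; apply: te; rewrite (ta e).
have [||w vw fw|p [q [w [Cw fp fq fw]]]] := @kempe v f t j fv vt.
- by move=> u vu; rewrite ft => /(tv _ vu).
- by rewrite ft -fy.
- by rewrite (yU w vw) ?fw // edge_sym.
have [[_ tp pq qw wv] [vp vq _ _ _]] := Cw.
(* The chain returns to v through y, the only neighbour of v with this colour, and reaches y through
   e. *)
have Ew : w = y by apply: yU; rewrite ?fy // edge_sym.
have Eq : q = e by apply: ey; rewrite -?Ew 1?edge_sym // fq.
subst w q; have pa : p != a by apply: contraTneq pq => ->; rewrite ae.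
have py : p != y by apply: contraFneq vp => ->; adj.
have pv : p != v by apply: contraTneq pq => ->; rewrite vq.
have ap : edge a p = false by apply: (partial_same fv); rewrite fp fa fy.
have yp : edge y p = false by apply: (partial_same fv); rewrite fp fy.
have xp : edge x p = false.
  by apply/negP=> xp; case/eqP: pa; apply: config_sole_a cf xp _; rewrite fy.
(* By [C5_link] at b, p would be adjacent to y, to a, or to both v and x. *)
have bp : edge b p = false.
  apply/negP=> bp; have := C5_link (C5_rot (C5_rot (C5_rot C))) py pa bp.
  by rewrite yp ap vp xp.
have C' : C5 t a b y v by do 2!split=> //; adj.
by have := C5_link C' pa pv tp; rewrite ap vp bp.
Qed.

Lemma no_path_at_y f v x a b y l t e : config f v x a b y -> off f x y l ->
  once f l v t -> once f l x e -> once f l a e -> once f l b t -> once f l y t ->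
  t <> e -> False.
Proof.
move=> /config_sym cf lo; intros; apply: (no_path_at_x cf (l := l) (t := t) (e := e)) => //.
by rewrite /off andbC.
Qed.

Lemma off_shift f v x a b y l : config f v x a b y -> off f x y l ->
  off (shift f v x) v a l.
Proof.
move=> cf /andP[lx ly]; have [fv [[_ xa ab _ _] [va vb _ _ _]] fa _ _ _ _] := cf.
rewrite /off /shift eqxx lx; have -> : (a == v) = false by apply: contraFF vb => /eqP<-.
by have -> : (a == x) = false; [apply: contraTF xa => /eqP->; adj | rewrite fa].
Qed.

Lemma no_path_at_v f v x a b y l t e : config f v x a b y -> off f x y l ->
  once f l v t -> once f l x t -> once f l a e -> once f l b e -> once f l y t ->
  t <> e -> False.
Proof.
move=> cf lo; have [fv _ _ _ _ _ _] := cf; have xl : f x != Some l by case/andP: lo; rewrite eq_sym.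
intros; apply: (no_path_at_x (config_rot cf) (off_shift cf lo) (t := t) (e := e)) => //;
  exact: once_shift.
Qed.

Lemma no_path_at_a f v x a b y l t e : config f v x a b y -> off f x y l ->
  once f l v e -> once f l x t -> once f l a t -> once f l b t -> once f l y e ->
  t <> e -> False.
Proof.
move=> cf lo; have [fv _ _ _ _ _ _] := cf; have xl : f x != Some l by case/andP: lo; rewrite eq_sym.
intros; apply: (no_path_at_y (config_rot cf) (off_shift cf lo) (t := t) (e := e)) => //;
  exact: once_shift.
Qed.

Lemma no_path_at_b f v x a b y l t e : config f v x a b y -> off f x y l ->
  once f l v e -> once f l x e -> once f l a t -> once f l b t -> once f l y t ->
  t <> e -> False.
Proof.
move=> /config_sym cf lo; intros; apply: (no_path_at_a cf (l := l) (t := t) (e := e)) => //.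
by rewrite /off andbC.
Qed.

(** With t uncoloured instead of v, two colours are repeated around t: one at x and b, the other at
    y and a. This contradicts [card_not_once]. *)
Lemma no_center f v x a b y l t : config f v x a b y -> off f x y l ->
  once f l v t -> once f l x t -> once f l a t -> once f l b t -> once f l y t -> False.
Proof.
move=> cf /andP[lx ly] [vt ft tv] [xt _ _] [at_ _ _] [bt _ _] [yt _ _].
have [fv [[vx xa ab yb yv] [va vb xb xy ay]] fa fb fxy xU yU] := cf.
have tU : sole f v t by move=> u vu; rewrite ft => /(tv _ vu).
have sw u i : f u = Some i -> Some i != Some l -> shift f v t u = Some i.
  by move=> fu il; apply/eqP; rewrite shift_eq ?fu // ft eq_sym.
have [i fx] := partial_Some fv vx; have [j fy] : exists j, f y = Some j.
  by apply: (partial_Some fv); rewrite edge_sym.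
have lot c p q : edge t p -> edge t q -> p != q -> f p = Some c -> f q = Some c ->
    Some l != Some c -> c \in [set c' | ncol (shift f v t) t c' != 1].
  move=> tp tq pq fp fq lc; rewrite inE neq_ltn; apply/orP; right; apply/card_gt1P.
  by exists p, q; split=> //; rewrite inE ?tp ?tq (sw _ c) ?eqxx // eq_sym.
have := card_not_once (partial_shift fv vt tU); rewrite leqNgt => /negP; apply.
apply/card_gt1P; exists i, j; split; last by apply: contraNneq fxy => ij; rewrite fx fy ij.
- by apply: (lot i x b); rewrite 1?edge_sym ?fb -?fx //; apply: contraTneq yb => <-; adj.
- by apply: (lot j y a); rewrite 1?edge_sym ?fa -?fy //; apply: contraTneq xa => <-; adj.
Qed.

(** This is [C5_link] for [t0]: a vertex of the cycle adjacent to [t0] has [t0] as its only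
    neighbour coloured [l]. *)
Lemma once_link f l (c0 c1 c2 c3 c4 t0 t1 t2 t3 t4 : G) : C5 c0 c1 c2 c3 c4 ->
  once f l c0 t0 -> once f l c1 t1 -> once f l c2 t2 -> once f l c3 t3 ->
  once f l c4 t4 -> f c1 != Some l -> f c4 != Some l ->
  [\/ t1 = t0, t4 = t0 | t2 = t0 /\ t3 = t0].
Proof.
move=> C [ct0 ft0 _] [_ _ e1] [_ _ e2] [_ _ e3] [_ _ e4] f1 f4.
have t01 : t0 != c1 by apply: contraNneq f1 => <-; rewrite ft0.
have t04 : t0 != c4 by apply: contraNneq f4 => <-; rewrite ft0.
case/or3P: (C5_link C t01 t04 ct0) => [c|c|/andP[c c']].
- by constructor 1; apply/esym/e1.
- by constructor 2; apply/esym/e4.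
- by constructor 3; split; apply/esym; [apply: e2 | apply: e3].
Qed.

(** By [once_link], the neighbours coloured [l] either coincide for the whole cycle, or coincide for
    three consecutive vertices and, separately, for the other two. The first case is [no_center],
    the second one of the [no_path] lemmas. *)
Lemma no_config f v x a b y : ~ config f v x a b y.
Proof.
move=> cf; have [l lo [[tv Hv] [tx Hx] [ta Ha] [tb Hb] [ty Hy]]] := exists_once cf.
(* By [once_link] at v, [tv] is shared with x or y, or with both a and b; in the last case
   [once_link] at x gives [tx = tv] again. *)
wlog tvx : x a b y cf lo tx Hx ta Ha tb Hb ty Hy / tx = tv => [main|].
  have side := main _ _ _ _ cf lo _ Hx _ Ha _ Hb _ Hy.
  have other : ty <> tv.
    by apply: main (config_sym cf) _ _ Hy _ Hb _ Ha _ Hx; rewrite /off andbC.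
  have [fv C fa fb _ _ _] := cf; case/andP: lo; rewrite eq_sym => xl; rewrite eq_sym => yl.
  case: (once_link C Hv Hx Ha Hb Hy xl yl) => // -[av bv].
  have al : f a != Some l by rewrite fa.
  have vl : f v != Some l by have [f0 _] := fv; have /eqP-> : f v == None by rewrite f0.
  case: (once_link (C5_rot C) Hx Ha Hb Hy Hv al vl) => [E|E|[E _]]; apply: side.
  - by rewrite -E.
  - by [].
  - by rewrite -E.
have [fv C fa fb _ _ _] := cf; have := lo; case/andP; rewrite eq_sym => xl; rewrite eq_sym => yl.
have al : f a != Some l by rewrite fa.
have bl : f b != Some l by rewrite fb.
have vl : f v != Some l by have [f0 _] := fv; have /eqP-> : f v == None by rewrite f0.
have Ca := C5_rot (C5_rot C); have Cb := C5_rot Ca; have Cy := C5_rot Cb.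
have La := once_link Ca Ha Hb Hy Hv Hx bl xl.
have Lb := once_link Cb Hb Hy Hv Hx Ha yl al.
have Ly := once_link Cy Hy Hv Hx Ha Hb vl bl.
rewrite {}tvx {tx} in Hx La Lb Ly.
have all_or : ta = tv -> tb = tv -> False.
  move=> av bv; rewrite {}av {}bv in Ha Hb La Lb Ly.
  have yv : ty = tv by case: Ly => [||[]].
  by rewrite yv in Hy; apply: no_center cf lo Hv Hx Ha Hb Hy.
have a_v : ta <> tv.
  move=> /[dup] av /all_or bNv; rewrite av in Ha.
  have yb : ty = tb by case: Lb => [//|ab|[vb _]]; case: bNv; rewrite -?ab.
  by rewrite yb in Hy; apply: no_path_at_x cf lo Hv Hx Ha Hb Hy _ => /esym.
case: La => [ba|/esym/a_v//|[_ /esym/a_v//]]; rewrite {}ba {tb} in Hb Lb Ly all_or.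
case: Ly => [vy|ay|[vy ay]].
- by rewrite -vy in Hy; apply: no_path_at_v cf lo Hv Hx Ha Hb Hy _ => /esym.
- by rewrite -ay in Hy; apply: no_path_at_b cf lo Hv Hx Ha Hb Hy a_v.
- by apply: a_v; rewrite ay.
Qed.

(** Otherwise the Kempe chain from x ends at y, the only neighbour of v with its colour, and closes
    up to a [config]. *)
Lemma sole_adj f v x y : partial v f -> edge v x -> edge v y -> sole f v x ->
  sole f v y -> x != y -> edge x y.
Proof.
move=> fv vx vy xU yU xNy; apply/negPn/negP=> /negPf xy.
have [j fy] := partial_Some fv vy.
have fxy : f x != f y by apply: contraNneq xNy => /(yU _ vx)->.
have [|w vw fw|a [b [w [C fa fb fw]]]] := @kempe v f x j fv vx xU.
- by rewrite -fy.
- by rewrite (yU w vw) // fw.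
have Ew : w = y by case: (C) => [[_ _ _ _ wv] _]; apply: yU; rewrite 1?edge_sym // fw.
subst w; apply: (@no_config f v x a b y); split=> //; by rewrite fa.
Qed.

(** * Cliques of size k *)

Hypothesis criticalG : forall v, exists f, partial v f.
Hypothesis cliqueG : forall K : {set G}, clique K -> #|K| <= k.

Lemma cliqueP (K : {set G}) :
  reflect {in K &, forall x y, x != y -> edge x y} (clique K).
Proof.
apply: (iffP forall_inP) => [KP x y xK yK xy|KP x xK].
  by have /forall_inP/(_ y yK)/implyP/(_ xy) := KP x xK.
by apply/forall_inP=> y yK; apply/implyP; apply: KP.
Qed.

Lemma cliqueU1 v (K : {set G}) : clique K -> {in K, forall u, edge v u} -> clique (v |: K).
Proof.
move=> /cliqueP KP vK; apply/cliqueP=> x y; rewrite !inE.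
case/predU1P=> [->|xK] /predU1P[->|yK]; first by rewrite eqxx.
- by rewrite vK.
- by rewrite edge_sym vK.
- exact: KP.
Qed.

Lemma no_adj_kclique v (K : {set G}) : clique K -> #|K| = k ->
  {in K, forall u, edge v u} -> False.
Proof.
move=> KP cK vK; have := cliqueG (cliqueU1 KP vK).
rewrite cardsU1 cK; case vinK: (v \in K); last by rewrite ltnn.
by have := vK v vinK; rewrite edge_irrefl.
Qed.

Record local_clique v (Q : {set G}) w1 w2 : Prop := LocalClique {
  lc_clique : clique Q;
  lc_card : #|Q| = k;
  lc_mem : v \in Q;
  lc_out1 : w1 \notin Q;
  lc_out2 : w2 \notin Q;
  lc_nbr : forall u, edge v u = [|| (u \in Q) && (u != v), u == w1 | u == w2];
  lc_neq : w1 != w2;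
  lc_nadj : edge w1 w2 = false;
  lc_adj : forall u, u \in Q -> edge u w1 || edge u w2 }.

(** The neighbours of v whose colours occur once form a clique. Some colour r is repeated, since
    otherwise v would complete a clique on k + 1 vertices; by the degree bound r occurs exactly
    twice, at [w1] and [w2]. *)
Lemma exists_local_clique v : exists Q w1 w2, local_clique v Q w1 w2.
Proof.
have [f fv] := criticalG v; have [f0 fP] := fv.
pose N := [set u | edge v u]; pose B := [set c | ncol f v c != 1].
have soleP u c : edge v u -> f u = Some c -> c \notin B -> sole f v u.
  move=> vu fu; rewrite inE negbK => /eqP/ncol1_once[t [_ _ tU]] w vw.
  by rewrite fu => /(tU _ vw)->; rewrite (tU u).
have sole_clique (A : {set G}) : A \subset N -> {in A, forall u, sole f v u} -> clique A.
  move=> /subsetP AN As; apply/cliqueP=> x y xA yA; apply: (sole_adj fv); do ?exact: As.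
    by have := AN x xA; rewrite inE.
  by have := AN y yA; rewrite inE.
have [r Br] : exists r, B = [set r].
  apply/cards1P; rewrite eqn_leq card_not_once // lt0n cards_eq0; apply/negP=> /eqP B0.
  apply: (@no_adj_kclique v N); last by move=> u; rewrite inE.
    apply: sole_clique => // u; rewrite inE => vu.
    by have [c fu] := partial_Some fv vu; apply: soleP vu fu _; rewrite B0 inE.
  rewrite -[#|N|](sum_ncol fv) (eq_bigr (fun=> 1)) ?sum1_card ?card_ord // => c _.
  by apply/eqP; have := in_set0 c; rewrite -B0 inE => /negbT/negPn.
have cN : #|N| = k.-1 + ncol f v r.
  rewrite -[#|N|](sum_ncol fv) (bigD1 r) //= addnC; congr (_ + _).
  rewrite (eq_bigr (fun=> 1)) => [|c]; first by rewrite sum1_card cardC1 card_ord.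
  by move=> cr; apply/eqP/negPn; have := in_set1 c r; rewrite -Br inE (negPf cr) => ->.
pose W := [set u | edge v u & f u == Some r]; pose U := N :\: W.
have WN : W \subset N by apply/subsetP=> u; rewrite !inE => /andP[].
have k0 : 0 < k by apply: leq_trans k_ge8.
have cW : #|W| = 2.
  apply/eqP; rewrite eqn_leq; apply/andP; split.
    by have := degG v; rewrite /degree -/N cN -{2}(prednK k0) -addn2 leq_add2l.
  have := set11 r; rewrite -Br inE /ncol -/W; have := ncol_gt0 r fv; rewrite /ncol -/W.
  by case: #|W| => [|[|]].
have cU : #|U| = k.-1 by rewrite cardsD (setIidPr WN) cN /ncol -/W addnK.
have vU : v \notin U by rewrite !inE edge_irrefl andbF.
have /cards2P[w1 [w2 [w12 WE]]] : #|W| == 2 by rewrite cW.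
have inW u : (edge v u && (f u == Some r)) = (u == w1) || (u == w2).
  by have := in_set2 u w1 w2; rewrite -WE inE.
have /andP[vw1 /eqP fw1] : edge v w1 && (f w1 == Some r) by rewrite inW eqxx.
have /andP[vw2 /eqP fw2] : edge v w2 && (f w2 == Some r) by rewrite inW eqxx orbT.
have Uadj u : u \in U -> edge v u by rewrite !inE => /andP[].
have Usole u : u \in U -> sole f v u.
  move=> uU; have vu := Uadj u uU; have [c fu] := partial_Some fv vu.
  apply: (soleP _ _ vu fu); rewrite Br inE; apply: contraTneq uU => cr.
  by rewrite !inE vu fu cr eqxx.
have outU w : (w == w1) || (w == w2) -> w \notin v |: U.
  rewrite -inW => /andP[vw /eqP fw]; rewrite !inE vw fw eqxx /= orbF.
  by apply: contraTneq vw => ->; rewrite edge_irrefl.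
exists (v |: U), w1, w2; split => //.
- by apply: cliqueU1 => //; apply: sole_clique => //; apply: subsetDl.
- by rewrite cardsU1 vU cU add1n prednK.
- exact: setU11.
- by rewrite outU ?eqxx.
- by rewrite outU ?eqxx ?orbT.
- move=> u; rewrite -inW !inE; case vu: (edge v u); rewrite ?andbF ?orbF ?andbT.
    by case: eqP vu => [->|_ _]; rewrite ?edge_irrefl //=; case: eqP.
  by rewrite andbN.
- by apply: (partial_same fv); rewrite fw1.
- move=> u /setU1P[->|uU]; first by rewrite vw1.
  have vu := Uadj u uU; have uU' := Usole u uU.
  (* If u missed both, a Kempe chain would give an induced 5-cycle v, u, a, b, w with w one of the
     two; the other one, w', is adjacent to v but to none of u, a, w, against [C5_link]. *)
  apply/negPn/negP; rewrite negb_or => /andP[/negPf uw1 /negPf uw2].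
  have fur : f u != Some r by move: uU; rewrite !inE vu andbT.
  have other w : edge v w -> f w = Some r -> (w == w1) || (w == w2).
    by move=> vw fw; rewrite -inW vw fw eqxx.
  have [w vw fw|a [b [w [C fa fb fw]]]] := @kempe v f u r fv vu uU' fur.
    by case/orP: (other w vw fw) => /eqP->.
  have [w' [vw' fw' uw' ww']] : exists w', [/\ edge v w', f w' = Some r, edge u w' = false & w' != w].
    have [[_ _ _ _ wv] _] := C; rewrite edge_sym in wv.
    case/orP: (other w wv fw) => /eqP->; last by exists w1.
    by exists w2; split=> //; rewrite eq_sym.
  have w'u : w' != u by apply: contra_neq fur => <-.
  have := C5_link C w'u ww' vw'; rewrite uw' (partial_same fv (u := w)) ?fw //.
  by rewrite (partial_same fv (u := a)) ?fa.
Qed.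

(** * Extending colourings *)

Lemma avoid_colors f (A : {set G}) (D : {set 'I_k}) : #|A| + #|D| < k ->
  exists2 c, c \notin D & {in A, forall w, f w != Some c}.
Proof.
move=> AD; pose F := [set c | Some c \in f @: A].
have FA : #|F| <= #|A|.
  rewrite -(card_imset _ (@Some_inj _)) (leq_trans _ (leq_imset_card f A)) //.
  by apply/subset_leq_card/subsetP=> _ /imsetP[c cF ->]; rewrite inE in cF.
have /subsetPn[c _] : ~~ ([set: 'I_k] \subset F :|: D).
  apply: contraL AD => /subset_leq_card; rewrite cardsT card_ord -leqNgt => /leq_trans; apply.
  by rewrite (leq_trans (leq_card_setU _ _).1) // leq_add2r.
rewrite !inE negb_or => /andP[cF cD]; exists c => // w wA.
by apply: contraNneq cF => <-; rewrite imset_f.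
Qed.

Definition independent (I : {set G}) := {in I &, forall u w, edge u w = false}.

Definition outside (M I : {set G}) := [set w | w \notin M & [exists u in I, edge u w]].

(* A colouring of G - (R :|: I1 :|: I2) extends: I1 and I2 get one colour each,
   and the remaining k - 2 colours suffice for R. *)
Lemma no_extension (R I1 I2 : {set G}) : let M := R :|: I1 :|: I2 in
  R != set0 -> #|R| + 2 <= k -> independent I1 -> independent I2 ->
  {in R, forall r u, edge r u -> u \in M} ->
  #|outside M I1| < k -> #|outside M I2| + 1 < k -> False.
Proof.
move=> M /set0Pn[r0 r0R] cR ind1 ind2 RM out1 out2.
have [f [f0 fP]] := criticalG r0.
have [c _ cP] : exists2 c, c \notin (set0 : {set 'I_k}) & {in outside M I1, forall w, f w != Some c}.
  by apply: avoid_colors; rewrite cards0 addn0.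
have [d] : exists2 d, d \notin [set c] & {in outside M I2, forall w, f w != Some d}.
  by apply: avoid_colors; rewrite cards1.
rewrite inE => dc dP.
(* The vertices of R receive pairwise distinct colours from [s], which lists all colours except [c]
   and [d]. *)
pose s := enum (~: [set c; d]); pose h u := nth c s (index u (enum R)).
have sz_s : #|R| <= size s.
  by rewrite -cardE [X in _ <= X]cardsCs setCK card_ord cards2 eq_sym dc leq_subRL ?(leq_trans _ cR) ?leq_addl // addnC.
have hs u : u \in R -> index u (enum R) < size s.
  by move=> uR; apply: leq_trans sz_s; rewrite cardE index_mem mem_enum.
have hcd u : u \in R -> (h u != c) && (h u != d).
  by move=> uR; have := mem_nth c (hs u uR); rewrite mem_enum !inE negb_or.
have h_inj : {in R &, injective h}.
  move=> u w uR wR /eqP; rewrite nth_uniq ?hs ?enum_uniq // => /eqP.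
  by apply: index_inj; rewrite ?mem_enum.
pose g u := if u \in R then h u else if u \in I1 then c else if u \in I2 then d
  else odflt c (f u).
have [u [w [uw]]] := uncolorable g.
have inR u' w' : edge u' w' -> u' \in R -> g u' != g w'.
  move=> uw' uR; have := RM _ uR _ uw'; rewrite !inE /g uR.
  case: ifP => [wR _|_].
    by apply/eqP=> /(h_inj _ _ uR wR) E; rewrite E edge_irrefl in uw'.
  by have /andP[hc hd] := hcd _ uR; case: ifP => //= _ ->.
have in1 u' w' : edge u' w' -> u' \notin R -> w' \notin R -> u' \in I1 -> g u' != g w'.
  move=> uw' /negPf uR /negPf wR u1; rewrite /g uR wR u1.
  case: ifP => [w1|w1]; first by rewrite ind1 in uw'.
  case: ifP => [_|w2]; first by rewrite eq_sym.
  have : w' \in outside M I1.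
    by rewrite !inE wR w1 w2; apply/existsP; exists u'; rewrite u1.
  move/cP; have := f0 w'; have -> : (w' == r0) = false by apply: contraFF wR => /eqP->.
  by case: (f w') => //= e _; rewrite eq_sym; apply: contraNN => /eqP->.
have in2 u' w' : edge u' w' -> u' \notin R -> w' \notin R -> u' \notin I1 -> w' \notin I1 ->
    u' \in I2 -> g u' != g w'.
  move=> uw' /negPf uR /negPf wR /negPf u1 /negPf w1 u2; rewrite /g uR wR u1 w1 u2.
  case: ifP => [w2|w2]; first by rewrite ind2 in uw'.
  have : w' \in outside M I2.
    by rewrite !inE wR w1 w2; apply/existsP; exists u'; rewrite u2.
  move/dP; have := f0 w'; have -> : (w' == r0) = false by apply: contraFF wR => /eqP->.
  by case: (f w') => //= e _; rewrite eq_sym; apply: contraNN => /eqP->.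
have wu : edge w u by rewrite edge_sym.
move/eqP; apply/negP; case uR: (u \in R); first exact: inR.
case wR: (w \in R); first by rewrite eq_sym; apply: inR.
case u1: (u \in I1); first by apply: in1; rewrite ?uR ?wR.
case w1: (w \in I1); first by rewrite eq_sym; apply: in1; rewrite ?uR ?wR.
case u2: (u \in I2); first by apply: in2; rewrite ?uR ?wR ?u1 ?w1.
case w2: (w \in I2); first by rewrite eq_sym; apply: in2; rewrite ?uR ?wR ?u1 ?w1.
rewrite /g uR wR u1 w1 u2 w2.
have := fP _ _ uw; have := f0 u; have := f0 w.
have -> : (u == r0) = false by apply: contraFF uR => /eqP->.
have -> : (w == r0) = false by apply: contraFF wR => /eqP->.
by case: (f u) => // i; case: (f w) => // j _ _ /=; apply: contraNN => /eqP->.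
Qed.

(** * Pairs of cliques of size k *)

Implicit Types M Q I : {set G}.

Definition kclique (Q : {set G}) := clique Q /\ #|Q| = k.

Lemma kclique_nbr Q v u : kclique Q -> v \in Q -> u \in Q -> u != v -> edge v u.
Proof. by case=> /cliqueP QP _ vQ uQ uv; apply: QP; rewrite // eq_sym. Qed.

Lemma no_adj_kclique_set Q v : kclique Q -> {in Q, forall u, edge v u} -> False.
Proof. by case; apply: no_adj_kclique. Qed.

(** The union lies in the closed neighbourhood of s. *)
Lemma kclique_meet Q Q' s : kclique Q -> kclique Q' -> s \in Q -> s \in Q' ->
  #|Q :|: Q'| <= k.+2.
Proof.
move=> KQ KQ' sQ sQ'; have : Q :|: Q' \subset s |: [set u | edge s u].
  apply/subsetP=> u; rewrite !inE; case: eqP => //= /eqP us.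
  by case/orP => uQ; [apply: kclique_nbr KQ _ _ _ | apply: kclique_nbr KQ' _ _ _].
move/subset_leq_card/leq_trans; apply; rewrite cardsU1 inE edge_irrefl add1n ltnS.
exact: degG.
Qed.

Lemma outsideU M I1 I2 : #|outside M (I1 :|: I2)| <= #|outside M I1| + #|outside M I2|.
Proof.
apply: leq_trans (leq_card_setU _ _).1; apply/subset_leq_card/subsetP => w.
rewrite !inE -andb_orr => /andP[-> /existsP[u]]; rewrite inE => /andP[/orP[] uI uw].
  by apply/orP; left; apply/existsP; exists u; rewrite uI.
by apply/orP; right; apply/existsP; exists u; rewrite uI.
Qed.

(** Of the at most k + 1 neighbours of u, k - 1 lie in Q. *)
Lemma outside_kclique M Q u : kclique Q -> u \in Q -> Q \subset M ->
  #|outside M [set u]| <= 2.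
Proof.
move=> KQ uQ QM; have [_ cQ] := KQ.
have sub : (Q :\ u) :|: outside M [set u] \subset [set w | edge u w].
  apply/subsetP=> w; rewrite !inE => /orP[/andP[wu wQ]|/andP[_ /existsP[u']]].
    exact: kclique_nbr KQ _ _ _.
  by rewrite inE => /andP[/eqP->].
have dis : [disjoint Q :\ u & outside M [set u]].
  rewrite disjoints_subset; apply/subsetP=> w; rewrite !inE => /andP[_ wQ].
  by rewrite (subsetP QM).
have := leq_trans (subset_leq_card sub) (degG u).
have cQu : #|Q :\ u| = k.-1 by have := cardsD1 u Q; rewrite uQ cQ => ->.
have k0 : 0 < k by apply: leq_trans k_ge8.
rewrite cardsU (disjoint_setI0 dis) cards0 subn0 cQu -{2}(prednK k0) -addn2.
by rewrite leq_add2l.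
Qed.

Lemma degree_eq v : degree v = k.+1.
Proof.
have [Q [w1 [w2 [QK cQ vQ w1Q w2Q nb w12 _ _]]]] := exists_local_clique v.
have k0 : 0 < k by apply: leq_trans k_ge8.
have -> : degree v = #|(Q :\ v) :|: [set w1; w2]|.
  by apply: eq_card => u; rewrite !inE nb andbC.
rewrite cardsU cards2 w12 (_ : _ :&: _ = set0) ?cards0 ?subn0.
  by have := cardsD1 v Q; rewrite vQ cQ add1n => ->; rewrite addn2.
apply/setP=> u; rewrite !inE; apply/negP=> /andP[/andP[_ uQ] /orP[]/eqP E].
  by rewrite -E uQ in w1Q.
by rewrite -E uQ in w2Q.
Qed.

(** One of [w1], [w2] has at least three neighbours in Q, as k > 4. The local clique at that vertex
    omits only two of its neighbours, so it contains one of these three. *)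
Lemma exists_meeting_kcliques : exists Q Q' s,
  [/\ kclique Q, kclique Q', s \in Q, s \in Q' & Q != Q'].
Proof.
have k0 : 0 < k by apply: leq_trans k_ge8.
(* The constant colouring serves only to produce a vertex. *)
have [v _] := uncolorable (fun=> Ordinal k0).
have [Q [w1 [w2 [QK cQ vQ w1Q w2Q nb w12 _ adj]]]] := exists_local_clique v.
have [w wQ cw] : exists2 w, w \notin Q & 2 < #|[set u in Q | edge u w]|.
  have QE : Q = [set u in Q | edge u w1] :|: [set u in Q | edge u w2].
    apply/setP=> u; rewrite !inE -andb_orr; case uQ: (u \in Q) => //=.
    by rewrite adj.
  case: (ltnP 2 #|[set u in Q | edge u w1]|) => [|c1]; first by exists w1.
  case: (ltnP 2 #|[set u in Q | edge u w2]|) => [|c2]; first by exists w2.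
  have := (leq_card_setU [set u in Q | edge u w1] [set u in Q | edge u w2]).1.
  rewrite -QE cQ => /leq_trans/(_ (leq_add c1 c2)) k4.
  by have := leq_trans k_ge8 k4.
have [Q' [v1 [v2 [QK' cQ' wQ' v1Q' v2Q' nb' _ _ _]]]] := exists_local_clique w.
have /subsetPn[s] : ~~ ([set u in Q | edge u w] \subset [set v1; v2]).
  apply: contraL cw => /subset_leq_card/leq_trans; rewrite -leqNgt; apply.
  by rewrite cards2; case: eqP.
rewrite !inE edge_sym nb' negb_or => /andP[sQ /or3P[/andP[sQ' _]|/eqP->|/eqP->]]; rewrite ?eqxx ?andbF // => _.
exists Q, Q', s; split=> //; by apply: contraNneq wQ => ->.
Qed.

Lemma card_kclique_diff Q Q' : kclique Q -> kclique Q' -> #|Q :\: Q'| = #|Q' :\: Q|.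
Proof. by case=> _ cQ [_ cQ']; rewrite !cardsD setIC cQ cQ'. Qed.

Lemma independent2 x y : edge x y = false -> independent [set x; y].
Proof. by move=> xy u w /set2P[]-> /set2P[]->; rewrite ?edge_irrefl // edge_sym. Qed.

(** No vertex is adjacent to a whole clique of size k, so the edges between the two differences form
    a matching, and these four vertices split into two nonadjacent pairs. With the pairs as colour
    classes, [no_extension] applies to the intersection. *)
Lemma kclique_diff_neq2 Q Q' : kclique Q -> kclique Q' -> #|Q :\: Q'| <> 2.
Proof.
move=> KQ KQ' cD; have [_ cQ] := KQ; have [_ cQ'] := KQ'.
have /eqP/cards2P[x1 [x2 [x12 DE]]] := cD.
have /eqP/cards2P[y1 [y2 [y12 DE']]] : #|Q' :\: Q| = 2 by rewrite -(card_kclique_diff KQ KQ').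
pose R := Q :&: Q'.
have cR : #|R| = k - 2 by have := cardsID Q' Q; rewrite cD cQ -/R => <-; rewrite addnK.
have xD u : (u \in Q :\: Q') = (u == x1) || (u == x2) by rewrite DE !inE.
have yD u : (u \in Q' :\: Q) = (u == y1) || (u == y2) by rewrite DE' !inE.
have /setDP[x1Q x1Q'] : x1 \in Q :\: Q' by rewrite xD eqxx.
have /setDP[x2Q x2Q'] : x2 \in Q :\: Q' by rewrite xD eqxx orbT.
have /setDP[y1Q' y1Q] : y1 \in Q' :\: Q by rewrite yD eqxx.
have /setDP[y2Q' y2Q] : y2 \in Q' :\: Q by rewrite yD eqxx orbT.
have RQ r : r \in R -> r \in Q by rewrite inE => /andP[].
have RQ' r : r \in R -> r \in Q' by rewrite inE => /andP[].
have mQ u : u \in Q -> [\/ u \in R, u = x1 | u = x2].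
  move=> uQ; case uQ': (u \in Q'); first by constructor 1; rewrite inE uQ uQ'.
  by have := xD u; rewrite inE uQ uQ' => /esym/orP[]/eqP; [constructor 2 | constructor 3].
have mQ' u : u \in Q' -> [\/ u \in R, u = y1 | u = y2].
  move=> uQ'; case uQ: (u \in Q); first by constructor 1; rewrite inE uQ uQ'.
  by have := yD u; rewrite inE uQ uQ' => /esym/orP[]/eqP; [constructor 2 | constructor 3].
have ny y : y \in Q' -> y \notin Q -> ~~ (edge x1 y && edge x2 y).
  move=> yQ' yQ; apply/negP=> /andP[x1y x2y]; apply: (no_adj_kclique_set KQ (v := y)).
  move=> u /mQ[uR|->|->]; rewrite 1?edge_sym //; apply: kclique_nbr KQ' _ _ _ => //.
    exact: RQ'.
  by apply: contraNneq yQ => ->; apply: RQ.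
have nx x : x \in Q -> x \notin Q' -> ~~ (edge x y1 && edge x y2).
  move=> xQ xQ'; apply/negP=> /andP[xy1 xy2]; apply: (no_adj_kclique_set KQ' (v := x)).
  move=> u /mQ'[uR|->|->] //; apply: kclique_nbr KQ _ _ _ => //.
    exact: RQ.
  by apply: contraNneq xQ' => <-; apply: RQ'.
wlog [xy1 xy2] : y1 y2 y12 DE' yD y1Q' y1Q y2Q' y2Q mQ' nx /
    edge x1 y1 = false /\ edge x2 y2 = false => [main|].
  have := ny _ y1Q' y1Q; have := ny _ y2Q' y2Q; have := nx _ x1Q x1Q'; have := nx _ x2Q x2Q'.
  case e11: (edge x1 y1); case e12: (edge x1 y2); case e21: (edge x2 y1);
    case e22: (edge x2 y2) => // _ _ _ _; try exact: (main y1 y2);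
    apply: (main y2 y1); rewrite 1?eq_sym //;
    do ?[by rewrite setUC | by move=> u; rewrite orbC
        |by move=> u /mQ'[]; [constructor 1|constructor 3|constructor 2]
        |by move=> u uQ uQ'; rewrite andbC nx].
have ME : R :|: [set x1; y1] :|: [set x2; y2] = Q :|: Q'.
  apply/setP=> u; rewrite !inE; have := xD u; have := yD u; rewrite !inE.
  by case: (u \in Q); case: (u \in Q'); case: (u == x1); case: (u == x2);
     case: (u == y1); case: (u == y2).
have k2 : 2 <= k by apply: leq_trans k_ge8.
have out x y : x \in Q -> y \in Q' -> #|outside (Q :|: Q') [set x; y]| <= 4.
  move=> xQ yQ'; apply: leq_trans (outsideU _ _ _) _; rewrite -[4]/(2 + 2) leq_add //.
    by apply: outside_kclique KQ xQ _; apply: subsetUl.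
  by apply: outside_kclique KQ' yQ' _; apply: subsetUr.
apply: (@no_extension R [set x1; y1] [set x2; y2]); rewrite ?ME.
- by rewrite -card_gt0 cR subn_gt0 (leq_trans _ k_ge8).
- by rewrite cR subnK.
- exact: independent2.
- exact: independent2.
(* Already k + 1 neighbours of r lie in the union. *)
- move=> r rR u ru; apply/negPn/negP=> uM.
  have /subset_leq_card : u |: (Q :|: Q') :\ r \subset [set w | edge r w].
    apply/subsetP=> w; rewrite !inE => /predU1P[->//|/andP[wr /orP[] w_]].
      by apply: kclique_nbr KQ (RQ r rR) _ _.
    by apply: kclique_nbr KQ' (RQ' r rR) _ _.
  rewrite cardsU1 !inE; have -> : #|(Q :|: Q') :\ r| = k.+1.
    have cU : #|Q :|: Q'| = k.+2.
      by rewrite cardsU -/R cR cQ cQ' -addnBA ?leq_subr // subKn // addn2.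
    by have := cardsD1 r (Q :|: Q'); rewrite cU inE (RQ r rR) add1n => -[<-].
  have -> : (u != r) && ((u \in Q) || (u \in Q')) = false.
    by move: uM; rewrite inE => /negPf->; rewrite andbF.
  by move/leq_trans/(_ (degG r)); rewrite ltnn.
- by apply: leq_ltn_trans (out _ _ x1Q y1Q') _; apply: leq_trans k_ge8.
- rewrite addn1; apply: leq_ltn_trans (_ : 5 < k); last exact: leq_trans k_ge8.
  by rewrite ltnS out.
Qed.

Lemma card_kcliqueU Q Q' : kclique Q -> kclique Q' -> #|Q :|: Q'| = k + #|Q :\: Q'|.
Proof.
case=> _ cQ [_ cQ']; have := cardsID Q' Q; rewrite cQ => E.
by rewrite cardsU cQ cQ' -E -addnBA ?leq_addr // addKn.
Qed.

Lemma kclique_diff1 Q Q' s : kclique Q -> kclique Q' -> s \in Q -> s \in Q' ->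
  Q != Q' -> #|Q :\: Q'| = 1.
Proof.
move=> KQ KQ' sQ sQ' QQ'; have := kclique_meet KQ KQ' sQ sQ'.
rewrite (card_kcliqueU KQ KQ') -addn2 leq_add2l.
have : #|Q :\: Q'| != 0.
  rewrite cards_eq0 setD_eq0; apply: contra QQ' => QQ'; rewrite eqEcard QQ'.
  by case: KQ KQ' => _ -> [_ ->] /=.
by have := kclique_diff_neq2 KQ KQ'; case: #|_| => [|[|[|]]].
Qed.

(** Each vertex of the intersection R has exactly one neighbour outside the union U, and it is the
    same vertex z for all of R. Then x, y, z are pairwise nonadjacent and can share a colour:
    [no_extension] applies with the classes {x, y, z} and {r0}. *)
Lemma no_kclique_diff1 Q Q' : kclique Q -> kclique Q' -> #|Q :\: Q'| <> 1.
Proof.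
move=> KQ KQ' cD; have [_ cQ] := KQ; have [_ cQ'] := KQ'.
have k0 : 0 < k by apply: leq_trans k_ge8.
have /eqP/cards1P[x DE] := cD.
have /eqP/cards1P[y DE'] : #|Q' :\: Q| = 1 by rewrite -(card_kclique_diff KQ KQ').
pose R := Q :&: Q'; pose U := Q :|: Q'.
have cR : #|R| = k.-1 by have := cardsID Q' Q; rewrite cD cQ -/R addn1 => <-.
have cU : #|U| = k.+1 by rewrite card_kcliqueU // cD addn1.
have xD u : (u \notin Q') && (u \in Q) = (u == x) by rewrite -in_setD DE inE.
have yD u : (u \notin Q) && (u \in Q') = (u == y) by rewrite -in_setD DE' inE.
have /andP[xQ' xQ] : (x \notin Q') && (x \in Q) by rewrite xD.
have /andP[yQ yQ'] : (y \notin Q) && (y \in Q') by rewrite yD.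
have RQ r : r \in R -> r \in Q by rewrite inE => /andP[].
have RQ' r : r \in R -> r \in Q' by rewrite inE => /andP[].
have UE u : (u \in U) = [|| u \in R, u == x | u == y].
  by rewrite !inE -xD -yD; case: (u \in Q); case: (u \in Q').
have QE u : u \in Q -> u != x -> u \in R.
  by rewrite -xD inE => uQ; rewrite uQ andbT negbK.
have QE' u : u \in Q' -> u != y -> u \in R.
  by rewrite -yD inE => uQ'; rewrite uQ' !andbT negbK.
have xy : edge x y = false.
  apply/negP=> xy; apply: (no_adj_kclique_set KQ (v := y)) => u uQ.
  case: (u =P x) => [->|/eqP ux]; first by rewrite edge_sym.
  apply: kclique_nbr KQ' _ _ _ => //; first by apply/RQ'/QE.
  by apply: contraNneq yQ => <-.
pose extra r := [set u | edge r u] :\: U.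
have RU r u : r \in R -> u \in U -> u != r -> edge r u.
  move=> rR; rewrite inE => /orP[] uQ ur.
    by apply: kclique_nbr KQ (RQ r rR) _ _.
  by apply: kclique_nbr KQ' (RQ' r rR) _ _.
have extra1 r : r \in R -> #|extra r| = 1.
  move=> rR; have := cardsID U [set u | edge r u]; rewrite -/(degree r) degree_eq.
  have -> : [set u | edge r u] :&: U = U :\ r.
    apply/setP=> u; rewrite in_setI in_setD1 in_set; case uU: (u \in U); rewrite ?andbF ?andbT //.
    by case: eqP => [->|/eqP ur]; [rewrite edge_irrefl | rewrite RU].
  have := cardsD1 r U; rewrite cU UE rR add1n => -[<-].
  by rewrite -addn1 => /addnI.
have extraP r u z : r \in R -> edge r u -> edge r z -> u \notin U -> z \notin U -> u = z.
  move=> rR ru rz uU zU; have /eqP/cards1P[t Et] := extra1 r rR.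
  have : u \in extra r by rewrite 2!inE uU.
  have : z \in extra r by rewrite 2!inE zU.
  by rewrite Et => /set1P-> /set1P->.
(* All of P except z lies in U, since r has a single neighbour outside U, and P contains at most one
   of x and y. *)
have key P r z : kclique P -> r \in R -> r \in P -> z \in P -> z \notin U ->
    k - 2 <= #|[set u in R | edge z u]|.
  move=> KP rR rP zP zU; have [_ cP] := KP.
  have rz : edge r z.
    by apply: kclique_nbr KP _ _ _ => //; apply: contraNneq zU => ->; rewrite UE rR.
  (* If P contains x or y, then [o] is that vertex. *)
  have [o oP] : exists o, forall u, u \in P -> (u == x) || (u == y) -> u = o.
    case xP: (x \in P); last by exists y => u uP /orP[]/eqP// E; rewrite -E uP in xP.
    exists x => u uP /orP[]/eqP// E; rewrite E in uP; case/negP: (negbT xy).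
    by apply: kclique_nbr KP _ _ _ => //; apply: contraNneq yQ => ->.
  have : P :\ z :\ o \subset [set u in R | edge z u].
    apply/subsetP=> u; rewrite !in_setD1 in_set => /and3P[uo uz uP].
    rewrite (kclique_nbr KP zP uP uz) andbT.
    have uU : u \in U.
      have [->|ur] := eqVneq u r; first by rewrite UE rR.
      apply: contraNT uz => uU; apply/eqP; apply: extraP rR _ rz uU zU.
      exact: kclique_nbr KP _ _ _.
    by move: uU; rewrite UE => /orP[//|/(oP _ uP)/eqP]; rewrite (negPf uo).
  move/subset_leq_card; apply: leq_trans.
  have := cardsD1 z P; rewrite zP cP add1n => E; rewrite E -[2]addn1 subSS leq_subLR.
  by rewrite (cardsD1 o (P :\ z)) leq_add2r; case: (_ \in _).
(* Let P be the local clique at r. If z is not in P, then z is [w1] or [w2], and P lies in U and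
   contains exactly one of x and y. For [key], a clique of size k through z and a vertex of R is
   then found at z. *)
have zdeg r z : r \in R -> edge r z -> z \notin U -> k - 2 <= #|[set u in R | edge z u]|.
  move=> rR rz zU; have [P [w1 [w2 [PK cP rP w1P w2P nb w12 _ adj]]]] := exists_local_clique r.
  case zP: (z \in P); first by apply: (key P r z).
  have PU u : u \in P -> u \in U.
    move=> uP; have [->|ur] := eqVneq u r; first by rewrite UE rR.
    apply: contraFT zP => uU; rewrite (extraP r z u rR) //.
    by apply: kclique_nbr uP ur.
  have z12 : (z == w1) || (z == w2) by have := nb z; rewrite rz zP.
  (* e and o are x and y, in some order. *)
  have side e o Qe : kclique Qe -> e \in Qe -> edge e o = false -> o \in U ->
      o != r -> e != r -> edge r e -> e \in P -> o \notin P ->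
      (forall u, u \in Qe -> u != e -> u \in R) -> k - 2 <= #|[set u in R | edge z u]|.
    move=> Ke eQ eo oU or er re eP oP QeR.
    have zo : z != o by apply: contraNneq zU => ->.
    have o12 : (o == w1) || (o == w2) by have := nb o; rewrite (negPf oP) RU.
    (* The two neighbours of r outside P are z and o; e is adjacent to one of them, but not to o. *)
    have ez : edge e z.
      have := adj e eP; case/orP: z12 => /eqP E; case/orP: o12 => /eqP E';
        by rewrite -?E -?E' ?eo ?orbF // in zo *; rewrite E E' eqxx in zo.
    have [P2 [v1 [v2 lc]]] := exists_local_clique z.
    have [P2K cP2 zP2 _ _ nb2 v12 nv12 _] := lc.
    (* As r and e are adjacent, they are not both among the nonadjacent [v1], [v2], so P2 contains r
       or e. If it contains e, it misses at most two vertices of [Qe] and so meets [Qe] in a vertex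
       of R. *)
    have [r' r'R r'P2] : exists2 r', r' \in R & r' \in P2.
      case rP2: (r \in P2); first by exists r.
      have eP2 : e \in P2.
        have := nb2 r; have := nb2 e; rewrite edge_sym ez edge_sym rz rP2 /=.
        case: (e \in P2) => //= /esym/orP[]/eqP E /esym/orP[]/eqP E';
          by rewrite ?E ?E' ?eqxx ?nv12 1?edge_sym ?nv12 in re er.
      have /card_gt0P[r'] : 0 < #|(Qe :&: P2) :\ e|.
        have KP2 : kclique P2 by [].
        have := kclique_meet Ke KP2 eQ eP2; rewrite card_kcliqueU // -addn2 leq_add2l => d2.
        have := cardsID P2 Qe; have [_ ->] := Ke; rewrite (cardsD1 e) inE eQ eP2 /=.
        rewrite lt0n; case: eqP => // -> ke; have := leq_trans k_ge8 (eq_leq (esym ke)).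
        by rewrite addn0 add1n ltnS leqNgt (leq_ltn_trans d2).
      rewrite !inE => /and3P[r'e r'Q r'P2]; exists r' => //; exact: QeR.
    exact: (key P2 r' z).
  have xr : x != r by apply: contraNneq xQ' => ->; apply: RQ'.
  have yr : y != r by apply: contraNneq yQ => ->; apply: RQ.
  have xU : x \in U by rewrite UE eqxx orbT.
  have yU : y \in U by rewrite UE eqxx !orbT.
  case xP: (x \in P); case yP: (y \in P).
  - case/negP: (negbT xy).
    by apply: kclique_nbr (conj PK cP) xP yP _; apply: contraNneq yQ => ->.
  - by apply: (side x y Q); rewrite ?yP //; apply: RU.
  - by apply: (side y x Q'); rewrite ?[edge y x]edge_sym ?xP //; apply: RU.
  - have /subset_leq_card : P \subset R.
      apply/subsetP=> u uP; have := PU u uP; rewrite UE.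
      by case/or3P=> // /eqP E; rewrite E ?xP ?yP in uP.
    by rewrite cP cR -{1}(prednK k0) ltnn.
have Rgt : 4 < #|R| by rewrite cR -ltnS prednK // (leq_trans _ k_ge8).
have /card_gt0P[r0 r0R] : 0 < #|R| by apply: leq_trans Rgt.
have /eqP/cards1P[z Ez] := extra1 r0 r0R.
have := set11 z; rewrite -Ez in_setD in_set => /andP[zU r0z].
(* The neighbourhoods of z and z' in R are large enough to meet, and a common vertex has only one
   neighbour outside U. *)
have Rz r : r \in R -> edge r z.
  move=> rR; have /eqP/cards1P[z' Ez'] := extra1 r rR.
  have := set11 z'; rewrite -Ez' in_setD in_set => /andP[zU' rz'].
  pose A := [set u in R | edge z u]; pose A' := [set u in R | edge z' u].
  have cA : k - 2 <= #|A| := zdeg r0 z r0R r0z zU.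
  have cA' : k - 2 <= #|A'| := zdeg r z' rR rz' zU'.
  have : 0 < #|A :&: A'|.
    apply: overlap_gt0 k_ge8 cA cA' _; rewrite -cardsUI -cR leq_add2r.
    by apply/subset_leq_card/subsetP=> u; rewrite in_setU !in_set => /orP[]/andP[].
  case/card_gt0P=> u /setIP[/setIdP[uR zu] /setIdP[_ zu']].
  by have -> : z = z' by apply: extraP uR _ _ zU zU'; rewrite edge_sym.
have Uz : {in R, forall r u, edge r u -> (u \in U) || (u == z)}.
  move=> r rR u ru; case uU: (u \in U) => //=; apply/eqP.
  by apply: extraP rR ru (Rz r rR) _ zU; rewrite uU.
have zR : z \notin R by move: zU; rewrite UE; apply: contra => ->.
have KR : kclique (z |: R).
  split; last by rewrite cardsU1 zR cR add1n prednK.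
  apply: cliqueU1 => [|u uR]; last by rewrite edge_sym Rz.
  by apply/cliqueP=> u w uR wR uw; apply: kclique_nbr KQ _ _ _; rewrite ?RQ // eq_sym.
have zN e Qe : kclique Qe -> R \subset Qe -> e \in Qe -> e \notin R -> edge e z = false.
  move=> Ke RQe eQ eR; apply/negP=> ez; apply: (no_adj_kclique_set KR (v := e)).
  move=> u /setU1P[->//|uR]; apply: kclique_nbr Ke eQ _ _; first exact: (subsetP RQe).
  by apply: contraNneq eR => <-.
have xR : x \notin R by apply: contra xQ' => /RQ'.
have yR : y \notin R by apply: contra yQ => /RQ.
have xz : edge x z = false by apply: zN KQ _ xQ xR; apply: subsetIl.
have yz : edge y z = false by apply: zN KQ' _ yQ' yR; apply: subsetIr.
have cRr : #|R :\ r0| = k - 2 by have := cardsD1 r0 R; rewrite r0R cR add1n subn2 => ->.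
pose I := [set x; y] :|: [set z]; pose M := (R :\ r0) :|: I :|: [set r0].
have ME : M = z |: U.
  apply/setP=> u; rewrite [RHS]in_setU1 UE !(in_setU, in_set1) in_setD1.
  case: (u =P r0) => [->|_] /=; first by rewrite r0R !orbT.
  by case: (u \in R); case: (u == x); case: (u == y); case: (u == z).
have UM : U \subset M by rewrite ME subsetUr.
have zM : z |: R \subset M.
  by rewrite ME setUS //; apply: subset_trans (subsetIl _ _) (subsetUl _ _).
have RM : {in R, forall r u, edge r u -> u \in M}.
  by move=> r rR u ru; rewrite ME in_setU1 orbC (Uz r rR u ru).
apply: (@no_extension (R :\ r0) I [set r0]).
- by rewrite -card_gt0 cRr subn_gt0 (leq_trans _ k_ge8).
- by rewrite cRr subnK // (leq_trans _ k_ge8).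
- move=> u w; rewrite !in_setU !in_set1.
  by case/orP=> [/orP[]|] /eqP-> /orP[/orP[]|] /eqP->; rewrite ?edge_irrefl 1?edge_sym // edge_sym.
- by move=> u w /set1P-> /set1P->; rewrite edge_irrefl.
- by move=> r /setD1P[_ rR]; apply: RM.
(* Each of x, y, z lies in a clique of size k inside M and so has at most two neighbours outside
   M. *)
- rewrite -/M; apply: leq_ltn_trans (_ : 6 < k); last exact: leq_trans k_ge8.
  rewrite -[6]/(2 + 2 + 2); apply: leq_trans (outsideU _ _ _) _.
  rewrite leq_add ?(outside_kclique KR) ?setU11 //.
  apply: leq_trans (outsideU _ _ _) _; rewrite leq_add //.
    by apply: outside_kclique KQ xQ (subset_trans (subsetUl _ _) UM).
  by apply: outside_kclique KQ' yQ' (subset_trans (subsetUr _ _) UM).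
- rewrite -/M (_ : outside M [set r0] = set0) ?cards0 ?(leq_trans _ k_ge8) //.
  apply/setP=> w; rewrite in_set0; apply/negP=> /setIdP[/negP wM /existsP[u]].
  by case/andP=> /set1P-> r0w; apply/wM/(RM r0).
Qed.

Lemma criticalF : False.
Proof.
have [Q [Q' [s [KQ KQ' sQ sQ' QQ']]]] := exists_meeting_kcliques.
exact: no_kclique_diff1 KQ KQ' (kclique_diff1 KQ KQ' sQ sQ' QQ').
Qed.

End Critical.

(** * From critical graphs to all graphs *)

(** By induction on the number of vertices every G - v is colourable, so a counterexample would be
    vertex-critical, which [criticalF] refutes. *)
Lemma colorable_of_free (G : sgraph) k :
  free P6 G -> free apple G -> free torch G -> 8 <= k ->
  (forall x : G, degree x <= k.+1) -> (forall K : {set G}, clique K -> #|K| <= k) ->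
  colorable G k.
Proof.
have [n] := ubnP #|G|; elim: n => // n IHn in G *.
rewrite ltnS => cG P6G appleG torchG k_ge8 degG cliqueG; apply: contraT => colG.
suff critG v : exists f : G -> option 'I_k, partial v f.
  by case: (criticalF P6G appleG torchG k_ge8 degG colG critG cliqueG).
pose S := [set~ v].
have : colorable (induced S) k.
  apply: IHn => //; try exact: free_induced.
  - rewrite card_sig; apply: leq_trans cG; rewrite -cardsT; apply: proper_card.
    by apply/properP; split; [apply/subsetP=> x | exists v]; rewrite !inE ?eqxx.
  - move=> x; apply: leq_trans (degG (val x)).
    rewrite /degree -(card_imset _ val_inj); apply/subset_leq_card/subsetP.
    by move=> _ /imsetP[y + ->]; rewrite !inE.
  - move=> K /cliqueP KP; rewrite -(card_imset _ val_inj); apply: cliqueG.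
    apply/cliqueP=> _ _ /imsetP[x xK ->] /imsetP[y yK ->] xy.
    by apply: (KP x y xK yK); apply: contraNneq xy => ->.
case/existsP=> h hP.
(* [insub] fails exactly at v, which f therefore leaves uncoloured. *)
pose f u := omap h (insub u : option {x : G | x \in S}); exists f; split=> [u|u w uw].
  by rewrite /f; case: insubP => [? + _|]; rewrite !inE ?negbK //= => /negPf->.
rewrite /f; case: insubP => [u' _ Eu|]; case: insubP => [w' _ Ew|] //=.
- have := forallP (forallP hP u') w'; rewrite /= /induced_edge Eu Ew uw /=.
  by apply: contraNneq => -[->].
- by rewrite !inE !negbK => /eqP Ew /eqP Eu; rewrite Ew Eu edge_irrefl in uw.
Qed.

Theorem theorem1p3 (G : sgraph)
  (P6_free : free P6 G) (apple_free : free apple G) (torch_free : free torch G)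
  (Delta_ge9 : 9 <= max_degree G) :
  chromatic_number G <= maxn (max_degree G - 1) (clique_number G).
Proof.
rewrite /chromatic_number; case: ex_minnP => m _; apply.
apply: colorable_of_free => //.
- by rewrite leq_max; lia.
- move=> x; have : degree x <= max_degree G by apply: leq_bigmax.
  by lia.
- by move=> K KP; rewrite leq_max [X in _ || X]leq_bigmax_cond ?orbT.
Qed.
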